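(* Let $S$ be a compact subset of a Euclidean space, let $(H_N)_{N\in\mathbb{N}}\subset C^1(\mathbb{R}^D,\mathbb{R})$ be a sequence and $H\in C^1(\mathbb{R}^D,\mathbb{R})$. Let $\nabla H|_x$, $\nabla H_N|_x$ denote the gradients at $x\in\mathbb{R}^D$. For $\theta\in C(S,\mathbb{R}^D)$ and $\epsilon>0$ define $$D_\theta^\epsilon=\{x\in\mathbb{R}^D:\ x=\theta(s)\pm\eta\ \text{for some } s\in S,\ \eta\in\mathbb{R}^D,\ |\eta|\le\epsilon\}$$ and assume that, for some $\epsilon>0$, $$\lim_{N\to\infty}\max_{x\in D_\theta^\epsilon}\big|\nabla H_N|_x-\nabla H|_x\big|=0.$$ Let $r_N\to\infty$ be a sequence of positive reals and $(X_N)_{N\in\mathbb{N}}$ a sequence of random fields in $C(S,\mathbb{R}^D)$ such that $$r_N(X_N-\theta)\rightsquigarrow X\quad\text{in } C(S,\mathbb{R}^D)$$ with $X$ a limiting random field in $C(S,\mathbb{R}^D)$. Then $$r_N\big(H_N(X_N)-H_N(\theta)\big)\rightsquigarrow\nabla H|_\theta\,X\quad\text{in } C(S,\mathbb{R}).$$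
   Context: $C(S,\mathbb{R}^D)$ is the Banach space of continuous functions $S\to\mathbb{R}^D$ with the maximum norm, and $\rightsquigarrow$ denotes weak convergence. $H_N(\theta)$ denotes $s\mapsto H_N(\theta(s))$, and $\nabla H|_\theta X$ denotes $s\mapsto\nabla H|_{\theta(s)}X(s)$, where the gradient acts as a row vector. *)

(* Defs.v *)
From HB Require Import structures.
From mathcomp Require Import all_boot all_order all_algebra.
From mathcomp Require Import all_classical all_reals all_analysis.

Set Implicit Arguments.
Unset Strict Implicit.
Unset Printing Implicit Defensive.

Import Order.TTheory GRing.Theory Num.Theory.
Import numFieldNormedType.Exports.

Local Open Scope classical_set_scope.
Local Open Scope ring_scope.

(* C(S, V). The proof that S is compact is a parameter of the type because the
   supremum is a norm only when every continuous function on S is bounded. *)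
Definition contSpace (R : realType) (T : topologicalType) (S : set T)
  (cS : compact S) (V : normedModType R) : Type := continuousType S V.

Section contSpace.
Context (R : realType) (T : topologicalType) (S : set T) (cS : compact S).
Context (V : normedModType R).
Local Notation C := (contSpace cS V).

Lemma contSpace_continuous (f : C) : continuous f.
Proof. by case: f => f [[]]. Qed.

Definition contSpaceMk (f : S -> V) (cf : continuous f) : C :=
  (mkcts cf : continuousType S V).

Lemma contSpace_eq (f g : C) : (forall s, f s = g s) -> f = g.
Proof. by move=> fg; exact/continuousEP. Qed.

Definition is_cont : {pred S -> V} := [pred f : S -> V | `[<continuous f>]].

Lemma is_contP (f : C) : (f : S -> V) \in is_cont.
Proof. by rewrite inE; exact: contSpace_continuous. Qed.

Definition contSpace_Sub (f : S -> V) (cf : f \in is_cont) : C :=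
  contSpaceMk (asboolW cf).

Lemma contSpace_rect (K : C -> Type) :
  (forall f (Pf : f \in is_cont), K (contSpace_Sub Pf)) -> forall u, K u.
Proof.
move=> KSub u.
suff -> : u = contSpace_Sub (is_contP u) by [].
exact: contSpace_eq.
Qed.

Lemma contSpace_valP f (Pf : f \in is_cont) :
  (contSpace_Sub Pf : S -> V) = f.
Proof. by []. Qed.

HB.instance Definition _ := isSub.Build _ _ C contSpace_rect contSpace_valP.
HB.instance Definition _ := [Choice of C by <:].

Lemma is_cont_submod_closed : submod_closed is_cont.
Proof.
split; first by rewrite inE => x; exact: (@cvg_cst V (0 : V) S (nbhs x)).
move=> a f g; rewrite !inE => cf cg x.
have ca : (fun=> a) @ nbhs x --> a by exact: (@cvg_cst R a S (nbhs x)).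
exact: cvgD (cvgZ ca (cf x)) (cg x).
Qed.
HB.instance Definition _ :=
  GRing.isSubmodClosed.Build _ _ is_cont is_cont_submod_closed.
HB.instance Definition _ := [SubChoice_isSubLmodule of C by <:].

Lemma contSpaceDE (f g : C) s : (f + g) s = f s + g s. Proof. by []. Qed.
Lemma contSpaceNE (f : C) s : (- f) s = - f s. Proof. by []. Qed.
Lemma contSpaceZE (a : R) (f : C) s : (a *: f) s = a *: f s. Proof. by []. Qed.
Lemma contSpace0E s : (0 : C) s = 0. Proof. by []. Qed.

Definition maxnorm (f : C) : R := sup (range (fun s => `|f s|)).

Lemma maxnorm_has_ubound (f : C) : has_ubound (range (fun s => `|f s|)).
Proof.
have cf : {within S, continuous (valL_ 0 f)}.
  exact/subspace_valL_continuousP'/contSpace_continuous.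
have /compact_bounded[M [_ HM]] := continuous_compact cf cS.
exists (M + 1) => _ [s _ <-]; apply: (HM (M + 1)); first by rewrite ltrDl.
exists (set_val s); first exact: set_valP.
by rewrite -[in RHS](@valLK _ _ (0 : V) S f).
Qed.

Lemma ler_maxnorm (f : C) s : `|f s| <= maxnorm f.
Proof. by apply: ub_le_sup; [exact: maxnorm_has_ubound|exists s]. Qed.

Lemma maxnorm_le (f : C) M : 0 <= M -> (forall s, `|f s| <= M) -> maxnorm f <= M.
Proof.
move=> M0 fM; have [[x Ex]|/set0P/negP/negPn/eqP E0] :=
  pselect (range (fun s => `|f s|) !=set0).
  by apply: ge_sup; [exists x|move=> _ [s _ <-]].
by rewrite /maxnorm E0 sup0.
Qed.

Lemma maxnorm_ge0 (f : C) : 0 <= maxnorm f.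
Proof.
have [[_ [s _ _]]|/set0P/negP/negPn/eqP E0] :=
  pselect (range (fun s => `|f s|) !=set0).
  exact: le_trans (ler_maxnorm f s).
by rewrite /maxnorm E0 sup0.
Qed.

Lemma maxnormD (f g : C) : maxnorm (f + g) <= maxnorm f + maxnorm g.
Proof.
apply: maxnorm_le => [|s]; first by rewrite addr_ge0 ?maxnorm_ge0.
by rewrite (le_trans (ler_normD _ _))// lerD ?ler_maxnorm.
Qed.

Lemma maxnormZ (a : R) (f : C) : maxnorm (a *: f) = `|a| * maxnorm f.
Proof.
have le b g : maxnorm (b *: g) <= `|b| * maxnorm g.
  apply: maxnorm_le => [|s]; first by rewrite mulr_ge0 ?maxnorm_ge0.
  by rewrite contSpaceZE normrZ ler_wpM2l ?ler_maxnorm.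
apply/eqP; rewrite eq_le le/=.
have [->|a0] := eqVneq a 0; first by rewrite normr0 mul0r maxnorm_ge0.
rewrite -{1}(scalerK a0 f) (le_trans (ler_wpM2l _ (le _ _)))//.
by rewrite normfV mulrA mulfV ?normr_eq0// mul1r.
Qed.

Lemma maxnorm_eq0 (f : C) : maxnorm f = 0 -> f = 0.
Proof.
move=> f0; apply: contSpace_eq => s; apply/eqP.
by rewrite contSpace0E -normr_le0 -f0 ler_maxnorm.
Qed.

HB.instance Definition _ :=
  Lmodule_isNormed.Build R C maxnormD maxnormZ maxnorm_eq0.

Lemma contSpace_normE (f : C) : `|f| = maxnorm f. Proof. by []. Qed.

End contSpace.

Section euclidean.
Context (R : realType).

(* The norm carried by matrices in the library is the maximum of the absolute
   values of the entries, hence this separate Euclidean norm. *)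
Definition enorm m n (A : 'M[R]_(m, n)) : R :=
  Num.sqrt (\sum_i \sum_j A i j ^+ 2).

Definition grad D (f : 'cV[R]_D -> R) (x : 'cV[R]_D) : 'rV[R]_D :=
  \row_i 'D_(delta_mx i 0) f x.

Record C1fun D := MkC1fun {
  C1fun_fun :> 'cV[R]_D -> R ;
  C1fun_diff : forall x, differentiable C1fun_fun x ;
  C1fun_grad : continuous (grad C1fun_fun) }.

Lemma C1fun_continuous D (H : C1fun D) : continuous H.
Proof. by move=> x; exact/differentiable_continuous/C1fun_diff. Qed.

End euclidean.

Section random_fields.
Context (R : realType) (T : topologicalType) (S : set T) (cS : compact S).
Context (D : nat).

Lemma contComp_subproof (H : C1fun R D) (f : contSpace cS 'cV[R]_D) :
  continuous (fun s => H (f s)).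
Proof.
by move=> s; apply: continuous_comp;
  [exact: contSpace_continuous|exact: C1fun_continuous].
Qed.

Definition contComp (H : C1fun R D) (f : contSpace cS 'cV[R]_D) :
  contSpace cS R := contSpaceMk cS (@contComp_subproof H f).

Lemma contGrad_subproof (H : C1fun R D) (f g : contSpace cS 'cV[R]_D) :
  continuous (fun s => (grad H (f s) *m g s) 0 0).
Proof.
move=> s.
have -> : (fun s => (grad H (f s) *m g s) 0 0) =
    (fun s => \sum_j grad H (f s) 0 j * g s j 0).
  by apply/funext => t; rewrite mxE.
apply: (@cvg_big R _ +%R 0 xpredT (@add_continuous R) S (nbhs s)) => j _.
apply: cvgM.
  apply: (@continuous_comp _ _ _ (fun s => grad H (f s))
    (fun M : 'rV[R]_D => M 0 j)); last exact: coord_continuous.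
  by apply: continuous_comp; [exact: contSpace_continuous|exact: C1fun_grad].
apply: (@continuous_comp _ _ _ g (fun M : 'cV[R]_D => M j 0)).
  exact: contSpace_continuous.
exact: coord_continuous.
Qed.

Definition contGrad (H : C1fun R D) (f g : contSpace cS 'cV[R]_D) :
  contSpace cS R := contSpaceMk cS (@contGrad_subproof H f g).

Definition tube (theta : contSpace cS 'cV[R]_D) (eps : R) : set 'cV[R]_D :=
  [set x | exists s (eta : 'cV[R]_D),
    enorm eta <= eps /\ (x = theta s + eta \/ x = theta s - eta)].

End random_fields.

Section weak_convergence.
Context (R : realType) (V : normedModType R).

Definition random_element d (Omega : measurableType d) (X : Omega -> V) :=
  measurable_fun setT (X : Omega -> g_sigma_algebraType (@open V)).

(* Each X_ n may live on its own probability space. *)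
Definition weak_cvg (d_ : nat -> measure_display)
    (Omega_ : forall n, measurableType (d_ n))
    (P_ : forall n, probability (Omega_ n) R) (X_ : forall n, Omega_ n -> V)
    d (Omega : measurableType d) (P : probability Omega R) (X : Omega -> V) :=
  [/\ forall n, random_element (X_ n), random_element X &
    forall f : V -> R, continuous f -> bounded_fun f ->
      (fun n => 'E_(P_ n)[f \o X_ n])%E @ \oo --> ('E_P[f \o X])%E].

End weak_convergence.

(* Main.v *)
Require Import Defs.
From mathcomp Require Import all_boot all_order all_algebra.
From mathcomp Require Import all_classical all_reals all_analysis.
From mathcomp Require Import measurable_realfun ring lra.

(** Let [Y_ N] be the rescaled field [r_ N *: (X_ N - theta)]. The quantity of
    interest is [G_ N (Y_ N)], where [G_ N y] is the rescaled increment
    [r_ N *: (H_ N (theta + y / r_ N) - H_ N theta)], and the candidate limit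
    is [G X] with [G y = grad H theta * y]. By the mean value theorem,
    [G_ N y s = grad (H_ N) (theta s + h) * y s] for some [h] of size at most
    [|y| / r_ N]. Once [r_ N] is large the point [theta s + h] lies in the
    tube, where [grad (H_ N)] is uniformly close to [grad H], and [grad H] is
    uniformly continuous near the compact range of [theta]. Hence [G_ N] tends
    to [G] uniformly on every ball ([rescaled_increment_cvg]).

    It remains to pass from [Y_ N ~> X] to [G_ N (Y_ N) ~> G X]
    ([weak_cvg_unif_bounded]). For a continuous [f] bounded by [B], the
    functions [minorant f B m] are continuous and bounded, they lie below [f
    \o G_ N] for all large [N], and they converge pointwise to [f \o G] as [m]
    grows. They combine a Lipschitz regularization of [f], which absorbs the
    difference between [G_ N] and [G] on a ball, with a cutoff that dominates
    the oscillation of [f] outside that ball. Weak convergence applied to one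
    minorant, together with dominated convergence in [m], gives the lower
    bound for the limit of the expectations of [f \o G_ N \o Y_ N]; the upper
    bound is the lower bound for [- f]. *)

Set Implicit Arguments.
Unset Strict Implicit.
Unset Printing Implicit Defensive.

Import Order.TTheory GRing.Theory Num.Theory.
Import numFieldNormedType.Exports.

Local Open Scope classical_set_scope.
Local Open Scope ring_scope.

(** * Lipschitz regularization *)

(** The inf-convolution of [f] with [k] times the norm, also known as the
    Pasch-Hausdorff envelope: for [k >= 0] and [f] bounded below, the largest
    [k]-Lipschitz minorant of [f]. *)
Definition infconv (R : realType) (V : normedModType R) (f : V -> R) (k : R)
  (x : V) : R := inf [set f y + k * `|x - y| | y in setT].

Section infconv.
Context (R : realType) (V : normedModType R) (f : V -> R) (B : R).
Hypothesis fB : forall x, `|f x| <= B.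

Let lo x : - B <= f x. Proof. by have := fB x; rewrite ler_norml => /andP[]. Qed.
Let hi x : f x <= B. Proof. by have := fB x; rewrite ler_norml => /andP[]. Qed.

Lemma infconv_le k x y : 0 <= k -> infconv f k x <= f y + k * `|x - y|.
Proof.
move=> k0; apply: ge_inf; last by exists y.
exists (- B) => _ [z _ <-].
by rewrite (le_trans (lo z))// lerDl mulr_ge0.
Qed.

Lemma infconv_ge k x c : (forall y, c <= f y + k * `|x - y|) ->
  c <= infconv f k x.
Proof.
move=> h; apply: lb_le_inf; first by exists (f x + k * `|x - x|), x.
by move=> _ [y _ <-].
Qed.

Lemma infconv_lef k x : 0 <= k -> infconv f k x <= f x.
Proof.
by move=> k0; have := infconv_le x x k0; rewrite subrr normr0 mulr0 addr0.
Qed.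

Lemma infconv_bounded k x : 0 <= k -> `|infconv f k x| <= B.
Proof.
move=> k0; rewrite ler_norml; apply/andP; split.
  apply: infconv_ge => y.
  by rewrite (le_trans (lo y))// lerDl mulr_ge0.
exact: le_trans (infconv_lef _ k0) (hi x).
Qed.

Lemma infconv_lipschitz k x y : 0 <= k ->
  `|infconv f k x - infconv f k y| <= k * `|x - y|.
Proof.
move=> k0.
have h u v : infconv f k u - k * `|u - v| <= infconv f k v.
  apply: infconv_ge => z; rewrite lerBlDr -addrA -mulrDr.
  rewrite (le_trans (infconv_le u z k0))// lerD2l ler_wpM2l//.
  by rewrite [leRHS]addrC ler_distD.
rewrite ler_norml; apply/andP; split.
  by have := h y x; rewrite distrC; lra.
by have := h x y; lra.
Qed.

Lemma infconv_continuous k : 0 <= k -> continuous (infconv f k).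
Proof.
move=> k0 x; apply/cvgrPdist_le => /= e e0.
have k1 : 0 < k + 1 by lra.
near=> y; rewrite (le_trans (infconv_lipschitz x y k0))//.
have : `|x - y| <= e / (k + 1).
  by near: y; apply: cvgr_dist_le => //; exact: divr_gt0.
rewrite ler_pdivlMr// => h; apply: le_trans h.
by rewrite mulrC ler_wpM2l// lerDl.
Unshelve. all: by end_near. Qed.

(** A point [y] competing in the infimum at [x] either lies so close to [x]
    that [f y] is almost [f x], or pays a penalty [n * d] that exceeds the
    oscillation [2 * B] of [f]. *)
Lemma infconv_cvg x : {for x, continuous f} ->
  (fun n => infconv f n.+1%:R x) @ \oo --> f x.
Proof.
move=> cf; apply/cvgrPdist_le => /= e e0.
have /cvgrPdist_le/(_ e e0)/nbhs_ballP[d /= d0 hd] := cf.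
near=> n.
have n0 : 0 <= n.+1%:R :> R by [].
rewrite ger0_norm ?subr_ge0 ?infconv_lef//.
rewrite lerBlDr -lerBlDl; apply: infconv_ge => y.
have [xy|xy] := ltP `|x - y| d.
  have := hd y; rewrite -ball_normE /= => /(_ xy).
  rewrite ler_norml => /andP[_ h].
  have : 0 <= n.+1%:R * `|x - y| by rewrite mulr_ge0.
  lra.
have h1 : 2 * B <= n.+1%:R * d.
  rewrite -ler_pdivrMr//.
  apply: (@le_trans _ _ n%:R); last by rewrite ler_nat.
  by near: n; exact: nbhs_infty_ger.
have h2 : n.+1%:R * d <= n.+1%:R * `|x - y| by rewrite ler_wpM2l.
have := lo y; have := hi x; lra.
Unshelve. all: by end_near. Qed.

End infconv.

(** * Expectations of continuous functions of a random element *)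

Section random_element.
Context (R : realType) d (Omega : measurableType d).

Lemma random_element_comp (U V : normedModType R) (g : U -> V)
    (Y : Omega -> U) :
  continuous g -> random_element Y -> random_element (g \o Y).
Proof.
move=> /continuousP cg mY.
apply: (@measurability _ _ Omega (g_sigma_algebraType (@open V)) _ _
  (@open V)) => //.
move=> _ [A oA <-]; rewrite setTI comp_preimage.
rewrite -[X in measurable X]setTI; apply: mY => //.
by apply: sub_sigma_algebra; exact: cg.
Qed.

Lemma random_element_measurable (U : normedModType R) (f : U -> R)
    (Y : Omega -> U) :
  continuous f -> random_element Y -> measurable_fun setT (f \o Y).
Proof.
move=> /continuousP cf mY.
apply: (measurability _ (RGenOpens.measurableE R)).
move=> _ [_ [a [b ->] <-]]; rewrite setTI comp_preimage.
rewrite -[X in measurable X]setTI; apply: mY => //.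
by apply: sub_sigma_algebra; apply: cf; exact: interval_open.
Qed.

Context (P : probability Omega R) (U : normedModType R) (Y : Omega -> U).
Hypothesis mY : random_element Y.

Lemma bounded_integrable (f : U -> R) B : continuous f ->
  (forall x, `|f x| <= B) -> P.-integrable setT (EFin \o (f \o Y)).
Proof.
move=> cf fB; apply: measurable_bounded_integrable => //.
- by rewrite [X in (X < _)%E]probability_setT ltry.
- exact: random_element_measurable.
- exists B; split; first exact: num_real.
  by move=> M BM w _; exact: le_trans (fB _) (ltW BM).
Qed.

Lemma expectation_Rintegral (f : U -> R) B : continuous f ->
  (forall x, `|f x| <= B) -> 'E_P[f \o Y]%E = (\int[P]_w f (Y w))%:E.
Proof.
move=> cf fB; rewrite unlock /Rintegral fineK//.
by apply: integrable_fin_num => //; exact: bounded_integrable fB.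
Qed.

Lemma Rintegral_dominated_cvg (f_ : nat -> U -> R) (f : U -> R) B :
  (forall m, continuous (f_ m)) -> continuous f ->
  (forall m x, `|f_ m x| <= B) -> (forall x, `|f x| <= B) ->
  (forall x, f_ ^~ x @ \oo --> f x) ->
  (fun m => \int[P]_w f_ m (Y w)) @ \oo --> \int[P]_w f (Y w).
Proof.
move=> cf_ cf fB_ fB h.
have [|||||_ _] := @dominated_convergence _ Omega R P setT measurableT
  (fun m w => (f_ m (Y w))%:E) (fun w => (f (Y w))%:E) (fun=> B%:E).
- by move=> m; apply/measurable_EFinP; exact: random_element_measurable.
- by apply/measurable_EFinP; exact: random_element_measurable.
- by apply: aeW => w _; apply: cvg_EFin; [exact: nearW|exact: h].
- by apply: (@bounded_integrable (fun=> B) `|B|) => // x; exact: cvg_cst.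
- by apply: aeW => w m _; rewrite /= lee_fin.
have fin : (\int[P]_w (f (Y w))%:E)%E \is a fin_num.
  by apply: integrable_fin_num => //; exact: bounded_integrable fB.
by rewrite -(fineK fin) => /fine_cvg.
Qed.

End random_element.

Lemma cvg_expectationP (R : realType) (U : normedModType R)
    (d_ : nat -> measure_display) (Omega_ : forall n, measurableType (d_ n))
    (P_ : forall n, probability (Omega_ n) R) (Y_ : forall n, Omega_ n -> U)
    d (Omega : measurableType d) (P : probability Omega R) (Y : Omega -> U)
    (f_ : nat -> U -> R) (f : U -> R) B :
  (forall n, random_element (@Y_ n)) -> random_element Y ->
  (forall n, continuous (f_ n)) -> continuous f ->
  (forall n y, `|f_ n y| <= B) -> (forall y, `|f y| <= B) ->
  (fun n => 'E_(P_ n)[f_ n \o @Y_ n])%E @ \oo --> 'E_P[f \o Y]%E <->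
  (fun n => \int[P_ n]_w f_ n (Y_ n w)) @ \oo --> \int[P]_w f (Y w).
Proof.
move=> mY_ mY cf_ cf fB_ fB.
rewrite (expectation_Rintegral P mY cf fB).
have -> : (fun n => 'E_(P_ n)[f_ n \o @Y_ n])%E =
    (fun n => (\int[P_ n]_w f_ n (Y_ n w))%:E).
  by apply/funext => n; exact: (expectation_Rintegral (P_ n) (mY_ n) (cf_ n)).
by split=> [/fine_cvg//|h]; apply: cvg_EFin => //; exact: nearW.
Qed.

(** * A continuous mapping theorem for maps converging on bounded sets *)

Section weak_cvg_unif.
Context (R : realType) (U V : normedModType R).
Context (d_ : nat -> measure_display) (Omega_ : forall n, measurableType (d_ n)).
Context (P_ : forall n, probability (Omega_ n) R) (Y_ : forall n, Omega_ n -> U).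
Arguments Y_ : clear implicits.
Context d (Omega : measurableType d) (P : probability Omega R) (Y : Omega -> U).
Context (G_ : nat -> U -> V) (G : U -> V).
Hypothesis cG_ : forall n, continuous (G_ n).
Hypothesis cG : continuous G.
Hypothesis G_cvg : forall M e : R, 0 < e ->
  \forall n \near \oo, forall y, `|y| <= M -> `|G y - G_ n y| <= e.
Hypothesis Y_cvg : weak_cvg P_ Y_ P Y.

(** A continuous function lying below [f \o G_ n] for all large [n]. On the
    ball of radius [m + 1] the maps [G_ n] are eventually so close to [G] that
    the [m + 1]-Lipschitz function [infconv f m.+1%:R] moves by at most
    [1 / (m + 1)], which is subtracted in advance; outside that ball the last
    term alone is [2 * B], which brings the value below [- B <= f]. *)
Let minorant (f : V -> R) (B : R) (m : nat) (y : U) : R :=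
  infconv f m.+1%:R (G y) - m.+1%:R^-1 - 2 * B * Num.min 1 (`|y| / m.+1%:R).

Section minorant.
Context (f : V -> R) (B : R).
Hypothesis cf : continuous f.
Hypothesis fB : forall x, `|f x| <= B.

Let B0 : 0 <= B. Proof. exact: le_trans (fB 0). Qed.

Let min1_continuous : continuous (Num.min 1 : R -> R).
Proof.
by move=> t; apply: (@continuous_min _ _ (fun=> 1) id);
  [exact: cvg_cst|exact: cvg_id].
Qed.

Let minorant_continuous m : continuous (minorant f B m).
Proof.
move=> y; apply: cvgB; first (apply: cvgB; last exact: cvg_cst).
  apply: (@continuous_comp _ _ _ G (infconv f m.+1%:R)); first exact: cG.
  exact: (infconv_continuous fB).
apply: cvgM; first exact: cvg_cst.
apply: (@continuous_comp _ _ _ (fun y : U => `|y| / m.+1%:R) (Num.min 1)).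
  by apply: cvgM; [exact: norm_continuous|exact: cvg_cst].
exact: min1_continuous.
Qed.

Let cut_ge0 m (y : U) : 0 <= Num.min 1 (`|y| / m.+1%:R) :> R.
Proof. by rewrite le_min ler01 divr_ge0. Qed.

Let cut_le1 m (y : U) : Num.min 1 (`|y| / m.+1%:R) <= 1 :> R.
Proof. by rewrite ge_min lexx. Qed.

Let minorant_bounded m y : `|minorant f B m y| <= 3 * B + 1.
Proof.
have h1 : `|infconv f m.+1%:R (G y)| <= B by exact: infconv_bounded.
have h2 : 0 < m.+1%:R^-1 :> R by [].
have h3 : m.+1%:R^-1 <= 1 :> R by rewrite invf_le1// ler1n.
have h4 : 0 <= 2 * B * Num.min 1 (`|y| / m.+1%:R) by rewrite !mulr_ge0.
have h5 : 2 * B * Num.min 1 (`|y| / m.+1%:R) <= 2 * B.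
  by rewrite ler_piMr// mulr_ge0.
move: h1; rewrite !ler_norml /minorant => /andP[h1 h1'].
set b := 2 * B * _ in h4 h5 *; set c := m.+1%:R^-1 in h2 h3 *.
by apply/andP; split; move: B0; lra.
Qed.

Let minorant_cvg y : (minorant f B ^~ y) @ \oo --> f (G y).
Proof.
have i0 : (fun m => m.+1%:R^-1 : R) @ \oo --> (0 : R).
  exact: (@cvg_harmonic R).
rewrite -[f (G y)]subr0 -[X in X - _]subr0 -[X in _ - _ - X](mulr0 (2 * B)).
apply: cvgB; first (apply: cvgB; last exact: i0).
  by apply: (infconv_cvg fB); exact: cf.
apply: cvgM; first exact: cvg_cst.
have -> : 0 = Num.min 1 (`|y| * 0) :> R by rewrite mulr0 min_r.
apply: (@cvg_comp _ _ _ (fun m => `|y| / m.+1%:R) (Num.min 1)).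
  by apply: cvgM; [exact: cvg_cst|exact: i0].
exact: min1_continuous.
Qed.

Let minorant_le m : \forall n \near \oo, forall y, minorant f B m y <= f (G_ n y).
Proof.
have k0 : 0 < m.+1%:R :> R by [].
have e0 : 0 < (m.+1%:R ^+ 2)^-1 :> R by rewrite invr_gt0 exprn_gt0.
near=> n => y.
have h1 : 0 <= 2 * B * Num.min 1 (`|y| / m.+1%:R) by rewrite !mulr_ge0.
have [ym|ym] := leP `|y| m.+1%:R.
  have h2 := infconv_le fB (G y) (G_ n y) (ltW k0).
  (* this is where the accuracy (m + 1)^-2 comes from: the Lipschitz constant
     m + 1 consumes one factor *)
  have h3 : m.+1%:R * `|G y - G_ n y| <= m.+1%:R^-1.
    rewrite -ler_pdivlMl// -invfM -expr2.
    by move: ym; move: y {h1 h2}; near: n; exact: G_cvg.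
  rewrite /minorant; set b := 2 * B * _ in h1 *; set c := m.+1%:R^-1 in h3 *.
  set t := m.+1%:R * _ in h2 h3; lra.
rewrite /minorant min_l; last by rewrite ler_pdivlMr// mul1r ltW.
have : `|infconv f m.+1%:R (G y)| <= B by exact: infconv_bounded.
set c := m.+1%:R^-1; have : 0 <= c by rewrite invr_ge0.
have := fB (G_ n y); rewrite !ler_norml => /andP[? ?] ? /andP[? ?]; lra.
Unshelve. all: by end_near. Qed.

(** The lower half of the convergence of the expectations of [f]: choose [m]
    so that the expectation of the minorant at the limit is within [e / 2] of
    that of [f \o G], by dominated convergence, and then apply weak
    convergence to this single minorant. The cutoff inside the minorant plays
    the part of tightness. *)
Lemma weak_cvg_liminf e : 0 < e ->
  \forall n \near \oo,
    \int[P]_w f (G (Y w)) - e <= \int[P_ n]_w f (G_ n (Y_ n w)).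
Proof.
move=> e0; have [mY_ mY YY] := Y_cvg.
have e20 : 0 < e / 2 by rewrite divr_gt0.
have cfG : continuous (f \o G).
  by move=> y; apply: continuous_comp; [exact: cG|exact: cf].
have cfG_ n : continuous (f \o G_ n).
  by move=> y; apply: continuous_comp; [exact: cG_|exact: cf].
have : (fun m => \int[P]_w minorant f B m (Y w)) @ \oo --> \int[P]_w f (G (Y w)).
  apply: (@Rintegral_dominated_cvg _ _ _ P _ _ mY _ (f \o G) (3 * B + 1)) => //.
  by move=> y; apply: le_trans (fB _) _; move: B0; lra.
move=> /cvgrPdist_le/(_ _ e20)[m _ /(_ m (leqnn m))/=].
rewrite ler_norml => /andP[_ hm].
have : (fun n => \int[P_ n]_w minorant f B m (Y_ n w)) @ \oo -->
    \int[P]_w minorant f B m (Y w).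
  apply/(cvg_expectationP P_ P mY_ mY (fun=> @minorant_continuous m)
    (@minorant_continuous m) (fun=> minorant_bounded m) (minorant_bounded m)).
  apply: YY; first exact: minorant_continuous.
  exists (3 * B + 1); split; first exact: num_real.
  by move=> M BM x _; exact: le_trans (minorant_bounded m x) (ltW BM).
move=> /cvgrPdist_le/(_ _ e20) hn.
near=> n.
have : `|\int[P]_w minorant f B m (Y w) -
         \int[P_ n]_w minorant f B m (Y_ n w)| <= e / 2 by near: n.
rewrite ler_norml => /andP[_ hn'].
have : \int[P_ n]_w minorant f B m (Y_ n w) <= \int[P_ n]_w f (G_ n (Y_ n w)).
  apply: le_Rintegral => //.
  - exact: (bounded_integrable (P_ n) (mY_ n) (@minorant_continuous m)
      (minorant_bounded m)).
  - exact: (bounded_integrable (P_ n) (mY_ n) (cfG_ n) (fun y => fB (G_ n y))).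
  - by move=> w _; move: (Y_ n w); near: n; exact: minorant_le.
lra.
Unshelve. all: by end_near. Qed.

End minorant.

(** The one-sided bound for [f] and the one for its opposite squeeze the
    expectations. *)
Lemma weak_cvg_unif_bounded :
  weak_cvg P_ (fun n => G_ n \o Y_ n) P (G \o Y).
Proof.
have [mY_ mY YY] := Y_cvg; split.
- by move=> n; exact: random_element_comp.
- exact: random_element_comp.
move=> f cf [B0 [_ fB0]]; set B := B0 + 1.
have fB x : `|f x| <= B by apply: fB0 => //; rewrite ltrDl.
have cfG : continuous (f \o G).
  by move=> y; apply: continuous_comp; [exact: cG|exact: cf].
have cfG_ n : continuous (f \o G_ n).
  by move=> y; apply: continuous_comp; [exact: cG_|exact: cf].
apply/(cvg_expectationP P_ P mY_ mY cfG_ cfG (fun n y => fB (G_ n y))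
  (fun y => fB (G y))).
apply/cvgrPdist_le => /= e e0.
have cNf : continuous (fun x => - f x) by move=> x; exact: cvgN (cf x).
have NfB x : `|- f x| <= B by rewrite normrN.
near=> n.
have h1 : \int[P]_w f (G (Y w)) - e <= \int[P_ n]_w f (G_ n (Y_ n w)).
  by near: n; exact: weak_cvg_liminf.
have h2 : \int[P]_w - f (G (Y w)) - e <= \int[P_ n]_w - f (G_ n (Y_ n w)).
  by near: n; apply: (weak_cvg_liminf cNf NfB).
have N1 : \int[P]_w - f (G (Y w)) = - \int[P]_w f (G (Y w)).
  under eq_Rintegral do rewrite -mulN1r.
  rewrite RintegralZl ?mulN1r//.
  exact: (bounded_integrable P mY cfG (fun y => fB (G y))).
have N2 : \int[P_ n]_w - f (G_ n (Y_ n w)) = - \int[P_ n]_w f (G_ n (Y_ n w)).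
  under eq_Rintegral do rewrite -mulN1r.
  rewrite RintegralZl ?mulN1r//.
  exact: (bounded_integrable (P_ n) (mY_ n) (cfG_ n) (fun y => fB (G_ n y))).
rewrite /= ler_norml; move: h2; rewrite N1 N2 => h2.
by apply/andP; split; lra.
Unshelve. all: by end_near. Qed.

End weak_cvg_unif.

(** * Compactness and matrix norms *)

Lemma eps_delta_continuous (R : realType) (V W : normedModType R) (g : V -> W) :
  (forall x e, 0 < e -> exists2 d : R, 0 < d &
     forall y, `|x - y| < d -> `|g x - g y| <= e) ->
  continuous g.
Proof.
move=> h x; apply/cvgrPdist_le => e e0; have [d d0 hd] := h x e e0.
by near=> y; apply: hd; near: y; exact: cvgr_dist_lt.
Unshelve. all: by end_near. Qed.

(** Uniform continuity of [g] at the points of a compact set [K], where the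
    perturbed point [x + h] may leave [K]. The filter of small [h] is the
    parameter of the near-covering form of compactness, so joint continuity of
    [(x, h) |-> g (x + h) - g x] at [(x, 0)] suffices. *)
Lemma near_compact_unif_continuous (R : realType) (V W : normedModType R)
    (K : set V) (g : V -> W) (e : R) : compact K -> continuous g -> 0 < e ->
  \forall h \near (0 : V), forall x, K x -> `|g (x + h) - g x| <= e.
Proof.
move=> cK cg e0.
move/compact_near_coveringP : cK => cK.
apply: (cK V (nbhs (0 : V)) (fun h x => `|g (x + h) - g x| <= e)).
move=> x _.
have e2 : 0 < e / 2 by rewrite divr_gt0.
have cx : \forall p \near (x, 0 : V), `|g x - g (p.1 + p.2)| <= e / 2.
  have : (fun p : V * V => g (p.1 + p.2)) @ (x, 0) --> g (x + 0).
    apply: (@cvg_comp _ _ _ (fun p : V * V => p.1 + p.2) g _ (nbhs (x + 0))).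
      by apply: cvgD; [exact: cvg_fst|exact: cvg_snd].
    exact: cg.
  by rewrite addr0 => /cvgrPdist_le; apply.
have cx1 : \forall p \near (x, 0 : V), `|g x - g p.1| <= e / 2.
  have : (fun p : V * V => g p.1) @ (x, 0) --> g x.
    apply: (@cvg_comp _ _ _ (fun p : V * V => p.1) g _ (nbhs x)).
      exact: cvg_fst.
    exact: cg.
  by move=> /cvgrPdist_le; apply.
near=> p; rewrite /= -(subrKA (g x)) (le_trans (ler_normD _ _))//.
rewrite (splitr e) lerD// 1?distrC.
  by near: p.
by rewrite distrC; near: p.
Unshelve. all: by end_near. Qed.

Section euclidean_norm.
Context (R : realType).

Lemma ler_mxE_norm m n (A : 'M[R]_(m, n)) i j : `|A i j| <= `|A|.
Proof.
rewrite [leRHS]/Num.norm/= mx_normrE.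
by apply: (le_bigmax _ (fun ij => `|A ij.1 ij.2|) (i, j)).
Qed.

Lemma ler_mxE_enorm m n (A : 'M[R]_(m, n)) i j : `|A i j| <= enorm A.
Proof.
rewrite -sqrtr_sqr ler_wsqrtr// (bigD1 i)//= (bigD1 j)//= -addrA lerDl addr_ge0//.
  by apply: sumr_ge0 => *; exact: sqr_ge0.
by apply: sumr_ge0 => *; apply: sumr_ge0 => *; exact: sqr_ge0.
Qed.

Lemma norm_le_enorm m n (A : 'M[R]_(m, n)) : `|A| <= enorm A.
Proof.
rewrite [leLHS]/Num.norm/= mx_normrE; apply/bigmax_leP; split; first exact: sqrtr_ge0.
by move=> ij _; exact: ler_mxE_enorm.
Qed.

Lemma enorm_le_norm m n (A : 'M[R]_(m, n)) : enorm A <= (m * n)%:R * `|A|.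
Proof.
have mn0 : 0 <= (m * n)%:R * `|A| by rewrite mulr_ge0.
rewrite -[leRHS]ger0_norm// -sqrtr_sqr ler_wsqrtr//.
apply: (@le_trans _ _ (\sum_(i < m) \sum_(j < n) `|A| ^+ 2)).
  apply: ler_sum => i _; apply: ler_sum => j _.
  by rewrite -[leLHS]real_normK ?num_real// ler_sqr ?nnegrE// ler_mxE_norm.
rewrite !sumr_const !card_ord -mulrnA mulnC -[leLHS]mulr_natl exprMn.
rewrite ler_wpM2r ?sqr_ge0// -natrX ler_nat.
by case: (m * n)%N => // k; rewrite expnS expn1 leq_pmulr.
Qed.

Lemma ler_row_mul_col D (M : 'rV[R]_D) (h : 'cV[R]_D) :
  `|(M *m h) 0 0| <= D%:R * `|M| * `|h|.
Proof.
rewrite mxE (le_trans (ler_norm_sum _ _ _))//.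
apply: (@le_trans _ _ (\sum_(j < D) `|M| * `|h|)).
  by apply: ler_sum => j _; rewrite normrM ler_pM ?ler_mxE_norm.
by rewrite sumr_const card_ord -[leLHS]mulr_natl mulrA.
Qed.

Lemma ler_norm_trmx m n (A : 'M[R]_(m, n)) : `|A^T| <= `|A|.
Proof.
rewrite [leLHS]/Num.norm/= mx_normrE; apply/bigmax_leP; split=> // ij _.
by rewrite mxE ler_mxE_norm.
Qed.

End euclidean_norm.

(** Heine-Borel for column vectors, carried over from row vectors by
    transposition. *)
Lemma continuous_bounded_cball (R : realType) (W : normedModType R) D
    (g : 'cV[R]_D -> W) (B : R) : continuous g ->
  exists C, forall x, `|x| <= B -> `|g x| <= C.
Proof.
move=> cg.
have cK : compact [set v : 'rV[R]_D | forall i, `[- B, B]%classic (v ord0 i)].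
  by apply: (@rV_compact R D (fun=> `[- B, B]%classic)) => _; exact: segment_compact.
have ct : continuous (trmx : 'rV[R]_D -> 'cV[R]_D).
  apply: eps_delta_continuous => v e e0; exists e => // w vw.
  by rewrite -raddfB/= (le_trans (ler_norm_trmx _))// ltW.
have cgt : {within [set v : 'rV[R]_D | forall i, `[- B, B]%classic (v ord0 i)],
   continuous (g \o trmx)}.
  apply: continuous_subspaceT => v; apply: continuous_comp; [exact: ct|exact: cg].
have /compact_bounded[C [_ hC]] := continuous_compact cgt cK.
exists (C + 1) => x xB; apply: (hC (C + 1)); first by rewrite ltrDl.
exists x^T; last by rewrite /= trmxK.
move=> i; rewrite /= in_itv/= mxE -ler_norml (le_trans _ xB)//.
by rewrite ler_mxE_norm.
Qed.

(** * Gradients and the mean value theorem *)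

Section mean_value.
Context (R : realType) (D : nat).

Lemma diff_grad (f : 'cV[R]_D -> R) x h : differentiable f x ->
  'd f x h = (grad f x *m h) 0 0.
Proof.
move=> df; rewrite [in LHS](matrix_sum_delta h) linear_sum mxE.
apply: eq_bigr => i _; rewrite big_ord1 linearZ/= !mxE deriveE// mulrC.
by rewrite -[RHS]/(h i 0 *: _).
Qed.

(** The one-variable theorem applied along the segment from [x] to [x + h]. *)
Lemma C1fun_mean_value (H : C1fun R D) (x h : 'cV[R]_D) :
  exists2 c : R, 0 <= c <= 1 & H (x + h) - H x = (grad H (x + c *: h) *m h) 0 0.
Proof.
pose g (t : R) := H (x + t *: h).
have dg (t : R) : is_derive t (1 : R) g ((grad H (x + t *: h) *m h) 0 0).
  have dl : is_diff t (fun s : R => x + s *: h) (fun s => s *: h).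
    have dcst := is_diff_cst x t.
    have dlin := is_diff_scalel t h.
    apply: (is_diff_eq (is_diffD dcst dlin)).
    by apply/funext => s; rewrite /= add0r.
  have dH : is_diff (x + t *: h) H ('d H (x + t *: h)).
    by apply: DiffDef => //; exact: C1fun_diff.
  have dgt := is_diff_comp dl dH.
  apply: DeriveDef.
    by apply: diff_derivable; exact: ex_diff.
  rewrite deriveE; last exact: ex_diff.
  by rewrite diff_val /= scale1r diff_grad//; exact: C1fun_diff.
have [|c c01] := @MVT _ g _ 0 1 ltr01 (fun t _ => dg t).
  apply: continuous_subspaceT => t; apply/differentiable_continuous/derivable1_diffP.
  by have [] := dg t.
rewrite /g scale1r scale0r addr0 subr0 mulr1 => ->; exists c => //.
by move: c01; rewrite in_itv/= => /andP[/ltW-> /ltW->].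
Qed.

End mean_value.

(** * Maps between spaces of continuous functions *)

Lemma increment_continuous (R : realType) (V W : normedModType R) (F : V -> W)
    (x : V) (a b : R) : continuous F ->
  continuous (fun y => a *: (F (x + b *: y) - F x)).
Proof.
move=> cF y; apply: cvgZr; apply: cvgB; last exact: cvg_cst.
apply: (@cvg_comp _ _ _ (fun y => x + b *: y) F _ (nbhs (x + b *: y))).
  by apply: cvgD; [exact: cvg_cst|apply: cvgZr; exact: cvg_id].
exact: cF.
Qed.

Section cont_space.
Context (R : realType) (T : topologicalType) (S : set T) (cS : compact S).

Lemma contSpace_compact_range (V : normedModType R) (f : contSpace cS V) :
  compact (range f).
Proof.
have cf : {within S, continuous (valL_ 0 f)}.
  exact/subspace_valL_continuousP'/contSpace_continuous.
have -> : range f = valL_ 0 f @` S; last exact: continuous_compact cf cS.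
apply/seteqP; split=> [_ [s _ <-]|_ [t St <-]].
  exists (set_val s); first exact: set_valP.
  by rewrite -[in RHS](@valLK _ _ (0 : V) S f).
exists (SigSub (mem_set St)) => //.
by rewrite -[in LHS](@valLK _ _ (0 : V) S f).
Qed.

Context (D : nat).
Implicit Types (H : C1fun R D) (theta y : contSpace cS 'cV[R]_D).

Let contCompE H theta s : contComp H theta s = H (theta s).
Proof. by []. Qed.

Let contGradE H theta y s :
  contGrad H theta y s = (grad H (theta s) *m y s) 0 0.
Proof. by []. Qed.

Lemma continuous_contComp H : continuous (contComp (cS := cS) H).
Proof.
apply: eps_delta_continuous => y e e0.
have := near_compact_unif_continuous (@contSpace_compact_range _ y)
  (@C1fun_continuous R D H) e0.
move=> /nbhs_ballP[d /= d0 hd].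
exists d => // z yz.
rewrite contSpace_normE; apply: maxnorm_le => [|s]; first exact: ltW.
rewrite contSpaceDE contSpaceNE !contCompE distrC.
have -> : z s = y s + (z - y) s.
  by rewrite contSpaceDE contSpaceNE addrCA subrr addr0.
apply: hd; last by exists s.
rewrite -ball_normE /= sub0r normrN (le_lt_trans (ler_maxnorm _ _))//.
by rewrite -contSpace_normE distrC.
Qed.

Lemma continuous_contGrad H theta : continuous (contGrad (cS := cS) H theta).
Proof.
apply: eps_delta_continuous => y e e0.
have [C hC] := continuous_bounded_cball `|theta| (@C1fun_grad R D H).
set K := D%:R * `|C| + 1.
have K0 : 0 < K by rewrite ltr_wpDl// mulr_ge0.
exists (e / K) => [|z yz]; first exact: divr_gt0.
rewrite contSpace_normE; apply: maxnorm_le => [|s]; first exact: ltW.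
rewrite contSpaceDE contSpaceNE !contGradE.
have -> : (grad H (theta s) *m y s) 0 0 - (grad H (theta s) *m z s) 0 0 =
    (grad H (theta s) *m (y - z) s) 0 0.
  by rewrite contSpaceDE contSpaceNE mulmxBr !mxE.
rewrite (le_trans (ler_row_mul_col _ _))//.
have {}yz : `|(y - z) s| <= e / K.
  by rewrite (le_trans (ler_maxnorm _ _))// -contSpace_normE ltW.
apply: (@le_trans _ _ (K * `|(y - z) s|)); last by rewrite -ler_pdivlMl// mulrC.
rewrite ler_wpM2r// ler_wpDr// ler_wpM2l//.
by rewrite (le_trans (hC _ (ler_maxnorm _ _)))// ler_norm.
Qed.

(** Needed because [sup] is 0 on unbounded sets: boundedness is what turns a
    small supremum into a bound on the gradients at every point of the tube. *)
Lemma tube_has_ubound (H1 H2 : C1fun R D) theta eps :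
  has_ubound [set enorm (grad H1 x - grad H2 x) | x in tube theta eps].
Proof.
have [C1 hC1] := continuous_bounded_cball (`|theta| + eps) (@C1fun_grad R D H1).
have [C2 hC2] := continuous_bounded_cball (`|theta| + eps) (@C1fun_grad R D H2).
exists ((1 * D)%:R * (C1 + C2)) => _ [x [s [eta [eta_eps xE]]] <-].
have xb : `|x| <= `|theta| + eps.
  have := le_trans (norm_le_enorm eta) eta_eps => etab.
  by case: xE => ->; [apply: le_trans (ler_normD _ _) _|
    apply: le_trans (ler_normB _ _) _]; rewrite lerD// ler_maxnorm.
rewrite (le_trans (enorm_le_norm _))// ler_wpM2l//.
by apply: le_trans (ler_normB _ _) _; apply: lerD; [exact: hC1|exact: hC2].
Qed.

(** The map sending the fluctuation [y = r *: (X - theta)] to the fluctuation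
    [r *: (H X - H theta)] that it causes. *)
Definition rescaled_increment (r : R) H theta y : contSpace cS R :=
  r *: (contComp H (theta + r^-1 *: y) - contComp H theta).

Lemma continuous_rescaled_increment r H theta :
  continuous (rescaled_increment r H theta).
Proof.
exact: (@increment_continuous R _ _ (contComp H) theta r r^-1
  (@continuous_contComp H)).
Qed.

(** The factor [r] cancels against the increment [r^-1 *: y s], so the
    rescaled increment is a gradient at a point that tends to [theta s],
    applied to [y s]. *)
Lemma rescaled_incrementE r H theta y s : r != 0 ->
  exists2 c : R, 0 <= c <= 1 & rescaled_increment r H theta y s =
    (grad H (theta s + c *: (r^-1 *: y s)) *m y s) 0 0.
Proof.
move=> r0; have [c c01 E] := C1fun_mean_value H (theta s) (r^-1 *: y s).
exists c => //; rewrite /rescaled_increment contSpaceZE contSpaceDE.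
rewrite contSpaceNE !contCompE contSpaceDE contSpaceZE E -scalemxAr mxE.
by rewrite -[LHS]/(_ * _) mulVKf.
Qed.

(** The differentiability of composition with [H_ N] along [theta], uniform on
    balls and with [H_ N] varying. By [rescaled_incrementE] the difference at
    [s] is a difference of two gradients applied to [y s]; passing through
    [grad H (theta s + h)], one part is controlled by the assumption on the
    tube and the other by uniform continuity of [grad H] near the range of
    [theta]. *)
Lemma rescaled_increment_cvg (H_ : nat -> C1fun R D) H theta eps (r_ : nat -> R)
    (M e : R) : 0 < eps ->
  (fun N => sup [set enorm (grad (H_ N) x - grad H x) | x in tube theta eps])
    @ \oo --> (0 : R) ->
  (forall N, 0 < r_ N) -> r_ @ \oo --> +oo -> 0 < e ->
  \forall N \near \oo, forall y, `|y| <= M ->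
    `|contGrad H theta y - rescaled_increment (r_ N) (H_ N) theta y| <= e.
Proof.
move=> eps0 gradH_cvg r_gt0 r_cvg e0.
set B := `|M| + 1; set K := (D%:R + 1 : R).
have B0 : 0 < B by rewrite ltr_wpDl.
have K0 : 0 < K by rewrite ltr_wpDl.
(* two gradient errors eta, the dimension factor K and the size B of y
   make up e *)
set eta := e / (2 * K * B).
have eta0 : 0 < eta by rewrite divr_gt0// !mulr_gt0.
have := near_compact_unif_continuous (@contSpace_compact_range _ theta)
  (@C1fun_grad R D H) eta0.
move=> /nbhs_ballP[d /= d0 hd].
near=> N => y yM.
have r0 : 0 < r_ N by [].
have supN :
    sup [set enorm (grad (H_ N) x - grad H x) | x in tube theta eps] <= eta.
  apply: le_trans (ler_norm _) _; rewrite -normrN -sub0r; near: N.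
  exact: cvgr_dist_le.
have rd : B / r_ N < d.
  rewrite ltr_pdivrMr// -ltr_pdivrMl// (@lt_le_trans _ _ (d^-1 * B + 1)) ?ltrDl//.
  by near: N; move/cvgryPge : r_cvg; apply.
have reps : K * (B / r_ N) <= eps.
  rewrite mulrA ler_pdivrMr// -ler_pdivrMl//.
  by near: N; move/cvgryPge : r_cvg; apply.
rewrite contSpace_normE; apply: maxnorm_le => [|s]; first exact: ltW.
have [c /andP[c0 c1] E] := rescaled_incrementE (H_ N) theta y s (lt0r_neq0 r0).
rewrite contSpaceDE contSpaceNE E contGradE.
set h := c *: _.
have yB : `|y s| <= B.
  rewrite (le_trans (ler_maxnorm _ _))// -contSpace_normE (le_trans yM)//.
  by rewrite (le_trans (ler_norm _))// lerDl.
have hB : `|h| <= B / r_ N.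
  rewrite /h !normrZ ger0_norm// normfV gtr0_norm// mulrC.
  rewrite mulrC -[leRHS]mul1r ler_pM// ?mulr_ge0 ?invr_ge0 ?(ltW r0)//.
  by rewrite mulrC ler_wpM2r// invr_ge0 ltW.
have hH : `|grad H (theta s + h) - grad H (theta s)| <= eta.
  apply: hd; last by exists s.
  by rewrite -ball_normE /= sub0r normrN (le_lt_trans hB).
have hHN : `|grad (H_ N) (theta s + h) - grad H (theta s + h)| <= eta.
  rewrite (le_trans (norm_le_enorm _))// (le_trans _ supN)//.
  apply: ub_le_sup; first exact: tube_has_ubound.
  exists (theta s + h) => //; exists s, h; split; last by left.
  rewrite (le_trans (enorm_le_norm _))// muln1 (le_trans _ reps)//.
  by rewrite ler_pM// lerDl.
have -> : (grad H (theta s) *m y s) 0 0 -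
      (grad (H_ N) (theta s + h) *m y s) 0 0 =
    ((grad H (theta s) - grad (H_ N) (theta s + h)) *m y s) 0 0.
  by rewrite mulmxBl !mxE.
rewrite (le_trans (ler_row_mul_col _ _))//.
have hG : `|grad H (theta s) - grad (H_ N) (theta s + h)| <= eta + eta.
  rewrite distrC -(subrKA (grad H (theta s + h))) (le_trans (ler_normD _ _))//.
  exact: lerD hHN hH.
have -> : e = K * (eta + eta) * B.
  by rewrite /eta; field; rewrite ?gt_eqF.
rewrite ler_pM ?mulr_ge0// ler_pM//.
by rewrite lerDl.
Unshelve. all: by end_near. Qed.

End cont_space.

Theorem lemma3 (R : realType) (k D : nat) (S : set 'cV[R]_k) (cS : compact S)
  (H_ : nat -> C1fun R D) (H : C1fun R D) (theta : contSpace cS 'cV[R]_D)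
  (eps : R) (eps_gt0 : 0 < eps)
  (gradH_cvg :
    (fun N => sup [set enorm (grad (H_ N) x - grad H x) | x in tube theta eps])
      @ \oo --> (0 : R))
  (r_ : nat -> R) (r_gt0 : forall N, 0 < r_ N) (r_cvg : r_ @ \oo --> +oo)
  (d_ : nat -> measure_display) (Omega_ : forall N, measurableType (d_ N))
  (P_ : forall N, probability (Omega_ N) R)
  (X_ : forall N, Omega_ N -> contSpace cS 'cV[R]_D)
  (X_rf : forall N, random_element (X_ N))
  (d : measure_display) (Omega : measurableType d) (P : probability Omega R)
  (X : Omega -> contSpace cS 'cV[R]_D) (rfX : random_element X)
  (X_cvg : weak_cvg P_ (fun N w => r_ N *: (X_ N w - theta)) P X) :
  weak_cvg P_
    (fun N w => r_ N *: (contComp (H_ N) (X_ N w) - contComp (H_ N) theta))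
    P (fun w => contGrad H theta (X w)).
Proof.
have -> : (fun N w => r_ N *: (contComp (H_ N) (X_ N w) - contComp (H_ N) theta))
    = (fun N => rescaled_increment (r_ N) (H_ N) theta \o
                (fun w => r_ N *: (X_ N w - theta))).
  apply: functional_extensionality_dep => N; apply/funext => w.
  rewrite /rescaled_increment /= scalerA mulVf ?gt_eqF// scale1r.
  by rewrite addrCA subrr addr0.
exact: (weak_cvg_unif_bounded
  (fun N => @continuous_rescaled_increment R _ S cS D (r_ N) (H_ N) theta)
  (@continuous_contGrad R _ S cS D H theta)
  (fun M e e0 => rescaled_increment_cvg M eps_gt0 gradH_cvg r_gt0 r_cvg e0)
  X_cvg).
Qed.
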